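(* Let $m,n\ge r\ge1$, let $L:\mathbb{R}^{m\times n}\to\mathbb{R}$ be differentiable, let $\lambda>0$ and $\tau>0$. For $A\in\mathbb{R}^{m\times r}$, $B\in\mathbb{R}^{n\times r}$ set $\mathcal{L}_{L2}(A,B)=L(AB^\top)+\frac{\lambda}{2}\left(\|A\|_F^2+\|B\|_F^2\right)$ and $\mathcal{L}_*(AB^\top)=L(AB^\top)+\lambda\|AB^\top\|_*$. Let $(A(t),B(t))_{t\ge0}$ be a solution of the gradient flow $\tau\dot A=-\nabla_A\mathcal{L}_{L2}(A,B)$, $\tau\dot B=-\nabla_B\mathcal{L}_{L2}(A,B)$. If $\|A(t)\|_F$ and $\|B(t)\|_F$ remain bounded for all $t\ge0$, then $\left|\mathcal{L}_{L2}(A(t),B(t))-\mathcal{L}_*(A(t)B(t)^\top)\right|$ converges exponentially fast to $0$ as $t\to\infty$.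
   Context: $\|\cdot\|_F$ is the Frobenius norm and $\|W\|_*=\operatorname{Tr}(\sqrt{WW^\top})$ the nuclear norm (sum of singular values). ''Converges exponentially fast to 0'' means bounded by $Ce^{-ct}$ for some constants $C,c>0$. *)

(* Defs.v *)
From HB Require Import structures.
From mathcomp Require Import all_boot all_order all_algebra.
From mathcomp Require Import all_classical all_reals all_analysis.
Set Implicit Arguments. Unset Strict Implicit. Unset Printing Implicit Defensive.
Import Order.TTheory GRing.Theory Num.Theory.
Import numFieldNormedType.Exports.
Local Open Scope classical_set_scope.
Local Open Scope ring_scope.

Section Defs.
Variable R : realType.

Definition frob_inner (p q : nat) (X Y : 'M[R]_(p, q)) : R := \tr (X^T *m Y).

Definition frob_norm (p q : nat) (X : 'M[R]_(p, q)) : R :=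
  Num.sqrt (\sum_(i < p) \sum_(j < q) X i j ^+ 2).

Definition psd (p : nat) (S : 'M[R]_p) : Prop :=
  S^T = S /\ forall v : 'rV[R]_p, 0 <= (v *m S *m v^T) 0 0.

Definition psd_sqrt (p : nat) (M : 'M[R]_p) : 'M[R]_p :=
  xget 0 [set S | psd S /\ S *m S = M].

Definition nuclear_norm (p q : nat) (W : 'M[R]_(p, q)) : R :=
  \tr (psd_sqrt (W *m W^T)).

Definition is_gradient (p q : nat) (f : 'M[R]_(p, q) -> R) (X G : 'M[R]_(p, q)) : Prop :=
  differentiable f X /\ forall H : 'M[R]_(p, q), 'd f X H = frob_inner G H.

Definition loss_L2 (m n r : nat) (L : 'M[R]_(m, n) -> R) (lambda : R)
  (A : 'M[R]_(m, r)) (B : 'M[R]_(n, r)) : R :=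
  L (A *m B^T) + lambda / 2 * (frob_norm A ^+ 2 + frob_norm B ^+ 2).

Definition loss_nuc (m n : nat) (L : 'M[R]_(m, n) -> R) (lambda : R)
  (W : 'M[R]_(m, n)) : R :=
  L W + lambda * nuclear_norm W.

End Defs.

(* Main.v *)
(* The directions H = A Z and K = B Z^T perturb A B^T in the same way, so testing the two
   gradient equations against them eliminates L and yields the conservation law
   tau D' = - 2 lambda D for the imbalance D = A^T A - B^T B, which therefore decays
   exponentially.  Put P = A A^T and let S be a positive semidefinite square root of
   W W^T, where W = A B^T.  Then (|A|^2 + |B|^2) / 2 = tr P - tr D / 2 and
   S^2 = P^2 - A D A^T, so the Powers--Stormer inequality
   |S - P|^2 <= sqrt m |S^2 - P^2| (Frobenius norms) bounds |tr S - tr P| by a constant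
   times sqrt |D|. *)

Require Import Defs.
From HB Require Import structures.
From mathcomp Require Import all_boot all_order all_algebra.
From mathcomp Require Import all_classical all_reals all_analysis.
From mathcomp Require Import complex ring lra.
Import Order.TTheory GRing.Theory Num.Theory.
Import numFieldNormedType.Exports.
Local Open Scope classical_set_scope.
Local Open Scope ring_scope.
Set Implicit Arguments. Unset Strict Implicit. Unset Printing Implicit Defensive.

(** * Functional calculus of a real symmetric matrix *)

Section FunctionalCalculus.
Variable R : realType.
Implicit Types f g : R -> R.

(** Newton interpolation: a new node is corrected by a multiple of [w], which vanishes at all
    earlier nodes and not at [b]. *)
Lemma interpolating_poly (s : seq R) f :
  exists p : {poly R}, forall a, a \in s -> p.[a] = f a.
Proof.
elim: s => [|b s [p hp]]; first by exists 0.
have [bs|bs] := boolP (b \in s).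
  by exists p => a; rewrite inE => /predU1P[->|]; exact: hp.
set w := \prod_(a <- s) ('X - a%:P).
have wb : w.[b] != 0.
  apply/negP => /eqP wb0; move/negP: bs; apply.
  by rewrite -root_prod_XsubC; apply/rootP.
exists (p + ((f b - p.[b]) / w.[b])%:P * w) => a; rewrite !hornerE.
rewrite inE => /predU1P[->|a_s]; first by rewrite divfK // subrKC.
have /rootP -> : root w a by rewrite root_prod_XsubC.
by rewrite mulr0 addr0 hp.
Qed.

(** Over [R[i]] the matrix is Hermitian, hence unitarily diagonalizable with real eigenvalues. These
    form [s], and p - q evaluated at the diagonal form is zero. *)
Lemma sym_horner_spectrum n (T : 'M[R]_n.+1) : T^T = T ->
  exists s : seq R, forall p q : {poly R},
    (forall a, a \in s -> p.[a] = q.[a]) -> horner_mx T p = horner_mx T q.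
Proof.
move=> symT.
pose rc : {rmorphism R -> R[i]} := real_complex R.
pose TC : 'M[R[i]]_n.+1 := map_mx rc T.
have hermTC : TC \is hermsymmx.
  apply: realsym_hermsym.
    by apply/is_hermitianmxP; rewrite expr0 scale1r map_mx_id // /TC map_trmx symT.
  by apply/mxOverP => i j; rewrite mxE /=; apply/complex_realP; exists (T i j).
have dreal := hermitian_spectral_diag_real hermTC.
have /orthomx_spectralP TCE := hermitian_normalmx hermTC.
exists [seq complex.Re (spectral_diag TC 0 i) | i : 'I_n.+1] => p q pq.
apply/eqP; rewrite -subr_eq0 -rmorphB /=; apply/eqP.
apply: (map_mx_inj (f := rc)).
rewrite map_horner_mx -/TC TCE.
rewrite horner_mx_uconjC; last exact: spectral_unit.
rewrite horner_mx_diag.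
suff -> : map_mx (horner (map_poly rc (p - q))) (spectral_diag TC) = 0.
  by rewrite raddf0 mulmx0 mul0mx raddf0.
apply/rowP => i; rewrite !mxE.
have /mxOverP/(_ 0 i)/complex_realP[x xE] := dreal.
rewrite xE (_ : x%:C%C = rc x) // horner_map /= hornerD hornerN pq ?subrr //.
by apply/mapP; exists i; rewrite ?mem_enum // xE.
Qed.

(** [Phi f] is p(T) for some p interpolating f on the spectrum. Its value does not depend on the
    choice of p, so pointwise identities between functions become matrix identities. *)
Lemma sym_functional_calculus n (T : 'M[R]_n.+1) : T^T = T ->
  exists Phi : (R -> R) -> 'M[R]_n.+1,
  [/\ forall f, (Phi f)^T = Phi f,
      Phi id = T /\ Phi (fun=> 1) = 1%:M,
      forall f g, Phi (f \+ g) = Phi f + Phi g,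
      forall f g, Phi (f \* g) = Phi f *m Phi g
    & forall c f, Phi (fun x => c * f x) = c *: Phi f].
Proof.
move=> symT; have [s hs] := sym_horner_spectrum symT.
have /choice[p hp] := interpolating_poly s.
exists (fun f => horner_mx T (p f)); split.
- move=> f; elim/poly_ind: (p f) => [|q c ih]; first by rewrite rmorph0 trmx0.
  rewrite rmorphD rmorphM /= horner_mx_X horner_mx_C linearD /= tr_scalar_mx.
  by rewrite trmx_mul ih symT; congr (_ + _); apply: comm_mx_horner.
- split; first by rewrite -[RHS]horner_mx_X; apply: hs => a /hp ->; rewrite hornerX.
  by rewrite -(horner_mx_C T); apply: hs => a /hp ->; rewrite hornerC.
- move=> f g; rewrite -rmorphD; apply: hs => a sa.
  by rewrite hornerD !hp.
- move=> f g; rewrite mulmxE -rmorphM; apply: hs => a sa.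
  by rewrite hornerM !hp.
- move=> c f; rewrite -horner_mxZ; apply: hs => a sa.
  by rewrite hornerZ !hp.
Qed.

End FunctionalCalculus.

(** * Positive semidefinite matrices and their traces *)

Section Psd.
Variable R : realType.

Lemma psd_gram p q (X : 'M[R]_(p, q)) : psd (X *m X^T).
Proof.
split=> [|v]; first by rewrite trmx_mul trmxK.
rewrite mulmxA -mulmxA -trmx_mul mxE; apply: sumr_ge0 => i _.
by rewrite [_^T _ _]mxE -expr2 sqr_ge0.
Qed.

Lemma psd_congr p q (S : 'M[R]_p) (X : 'M[R]_(q, p)) : psd S -> psd (X *m S *m X^T).
Proof.
move=> [symS posS]; split=> [|v].
  by rewrite !trmx_mul trmxK symS mulmxA.
by have := posS (v *m X); rewrite trmx_mul !mulmxA.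
Qed.

Lemma psd_tr_ge0 p (S : 'M[R]_p) : psd S -> 0 <= \tr S.
Proof.
move=> [_ posS]; apply: sumr_ge0 => i _.
have := posS (delta_mx 0 i); rewrite -rowE mxE (bigD1 i) //= big1 => [|j /negPf ji].
  by rewrite addr0 !mxE !eqxx mulr1.
by rewrite !mxE ji andbF mulr0.
Qed.

Lemma psd_tr_gramM_ge0 p (G S : 'M[R]_p) : G^T = G -> psd S -> 0 <= \tr (G *m G *m S).
Proof.
move=> symG /(psd_congr G)/psd_tr_ge0.
by rewrite symG mxtrace_mulC mulmxA.
Qed.

(** A nonnegative f is the square of sqrt f, so [Phi f] = G G with G symmetric. This is a Gram
    matrix, and tr (G G M) = tr (G M G) is nonnegative for psd M. *)
Lemma sym_functional_calculus_psd n (T : 'M[R]_n.+1) : T^T = T ->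
  exists Phi : (R -> R) -> 'M[R]_n.+1,
  [/\ Phi id = T /\ Phi (fun=> 1) = 1%:M,
      forall f g, Phi (f \+ g) = Phi f + Phi g,
      forall f g, Phi (f \* g) = Phi f *m Phi g,
      forall c f, Phi (fun x => c * f x) = c *: Phi f
    & (forall f, (Phi f)^T = Phi f) /\
      forall f, (forall x, 0 <= f x) -> psd (Phi f) /\
        forall M : 'M[R]_n.+1, psd M -> 0 <= \tr (Phi f *m M)].
Proof.
move=> /sym_functional_calculus[Phi [symPhi Phi1 PhiD PhiM PhiZ]].
exists Phi; split=> //; split=> // f f0.
have -> : f = (Num.sqrt \o f) \* (Num.sqrt \o f).
  by apply/funext => x /=; rewrite -expr2 sqr_sqrtr.
rewrite PhiM; split=> [|M]; last exact: psd_tr_gramM_ge0.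
by rewrite -{2}symPhi; exact: psd_gram.
Qed.

End Psd.

(** * Cauchy--Schwarz and Frobenius norm estimates *)

Section Frobenius.
Variable R : realType.

Lemma sqr_sum_mul_le (I : finType) (x y : I -> R) :
  (\sum_i x i * y i) ^+ 2 <= (\sum_i x i ^+ 2) * (\sum_i y i ^+ 2).
Proof.
set a := \sum_i x i ^+ 2; set b := \sum_i y i ^+ 2; set c := \sum_i x i * y i.
have a0 : 0 <= a by apply: sumr_ge0 => i _; exact: sqr_ge0.
have [a_eq0|a_neq0] := eqVneq a 0.
  have x0 i : x i = 0.
    apply/eqP; rewrite -sqrf_eq0; move/eqP: a_eq0.
    rewrite psumr_eq0 => [/allP/(_ i)|? _]; last exact: sqr_ge0.
    by rewrite mem_index_enum => /(_ isT).
  by rewrite /c big1 ?expr0n /= ?a_eq0 ?mul0r // => i _; rewrite x0 mul0r.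
(* Up to scaling by a, this is the squared residual of y after projection onto x. *)
have : 0 <= \sum_i (a * y i - c * x i) ^+ 2 by apply: sumr_ge0 => i _; exact: sqr_ge0.
have -> : \sum_i (a * y i - c * x i) ^+ 2 = a * (a * b - c ^+ 2).
  transitivity (a ^+ 2 * (\sum_i y i ^+ 2) - 2 * a * c * (\sum_i x i * y i)
                + c ^+ 2 * (\sum_i x i ^+ 2)); last by rewrite -/a -/b -/c; ring.
  rewrite !(mulr_sumr _ _ _ (a ^+ 2), mulr_sumr _ _ _ (2 * a * c)).
  rewrite (mulr_sumr _ _ _ (c ^+ 2)) -sumrB -big_split /=.
  by apply: eq_bigr => i _; ring.
by rewrite pmulr_rge0 ?subr_ge0 // lt_def a_neq0.
Qed.

Lemma frob_norm_ge0 p q (X : 'M[R]_(p, q)) : 0 <= frob_norm X.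
Proof. exact: sqrtr_ge0. Qed.

Lemma sqr_frob_norm p q (X : 'M[R]_(p, q)) :
  frob_norm X ^+ 2 = \sum_i \sum_j X i j ^+ 2.
Proof.
by rewrite sqr_sqrtr //; do 2!apply: sumr_ge0 => ? _; exact: sqr_ge0.
Qed.

Lemma frob_norm_eq0 p q (X : 'M[R]_(p, q)) : frob_norm X = 0 -> X = 0.
Proof.
move=> X0; have := sqr_frob_norm X; rewrite X0 expr0n => /esym/eqP.
have sq0 i : 0 <= \sum_j X i j ^+ 2 by apply: sumr_ge0 => j _; exact: sqr_ge0.
rewrite psumr_eq0 // => /allP X_eq0; apply/matrixP => i j; rewrite mxE.
have := X_eq0 i (mem_index_enum _); rewrite psumr_eq0 => [/allP|? _]; last exact: sqr_ge0.
by move=> /(_ j (mem_index_enum _)); rewrite sqrf_eq0 => /eqP.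
Qed.

Lemma frob_innerE p q (X Y : 'M[R]_(p, q)) :
  frob_inner X Y = \sum_i \sum_j X i j * Y i j.
Proof.
rewrite /frob_inner /mxtrace exchange_big /=; apply: eq_bigr => j _.
by rewrite mxE; apply: eq_bigr => i _; rewrite mxE.
Qed.

Lemma sqr_frob_norm_inner p q (X : 'M[R]_(p, q)) : frob_norm X ^+ 2 = frob_inner X X.
Proof. by rewrite sqr_frob_norm frob_innerE. Qed.

Lemma normr_frob_inner_le p q (X Y : 'M[R]_(p, q)) :
  `|frob_inner X Y| <= frob_norm X * frob_norm Y.
Proof.
rewrite -ler_sqr ?nnegrE ?normr_ge0 ?mulr_ge0 ?frob_norm_ge0 //.
rewrite real_normK ?num_real // exprMn !sqr_frob_norm frob_innerE !pair_bigA /=.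
exact: sqr_sum_mul_le.
Qed.

Lemma frob_norm_mul_le p q s (X : 'M[R]_(p, q)) (Y : 'M[R]_(q, s)) :
  frob_norm (X *m Y) <= frob_norm X * frob_norm Y.
Proof.
rewrite -ler_sqr ?nnegrE ?mulr_ge0 ?frob_norm_ge0 //.
rewrite exprMn !sqr_frob_norm (exchange_big _ _ _ _ _ (fun i j => Y i j ^+ 2)) /=.
rewrite mulr_suml; apply: ler_sum => i _; rewrite mulr_sumr.
by apply: ler_sum => j _; rewrite mxE; exact: sqr_sum_mul_le.
Qed.

Lemma frob_norm_tr p q (X : 'M[R]_(p, q)) : frob_norm X^T = frob_norm X.
Proof.
rewrite /frob_norm exchange_big /=; congr Num.sqrt.
by do 2![apply: eq_bigr => ? _]; rewrite mxE.
Qed.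

Lemma frob_normZ p q (a : R) (X : 'M[R]_(p, q)) : frob_norm (a *: X) = `|a| * frob_norm X.
Proof.
rewrite /frob_norm -sqrtr_sqr -sqrtrM ?sqr_ge0 //; congr Num.sqrt.
rewrite mulr_sumr; apply: eq_bigr => i _; rewrite mulr_sumr; apply: eq_bigr => j _.
by rewrite mxE exprMn.
Qed.

Lemma sqr_frob_norm1 p : frob_norm (1%:M : 'M[R]_p) ^+ 2 = p%:R.
Proof. by rewrite sqr_frob_norm_inner /frob_inner trmx1 mul1mx mxtrace1. Qed.

Lemma normr_tr_le p (X : 'M[R]_p) : `|\tr X| <= Num.sqrt p%:R * frob_norm X.
Proof.
have -> : \tr X = frob_inner 1%:M X by rewrite /frob_inner trmx1 mul1mx.
apply: le_trans (normr_frob_inner_le _ _) _.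
by rewrite -sqr_frob_norm1 sqrtr_sqr ger0_norm ?frob_norm_ge0.
Qed.

End Frobenius.

(** * Square roots and the Powers--Stormer inequality *)

Section SquareRoot.
Variable R : realType.

(** Applying sqrt |x| to M gives a psd root of |M|. It remains to see that |M| = M, that is, that
    |x| - x is sent to 0. Existence ensures that [psd_sqrt] picks a genuine root and not its default
    0. *)
Lemma psd_sqrt_exists n (M : 'M[R]_n.+1) : psd M -> exists S, psd S /\ S *m S = M.
Proof.
move=> psdM.
have [Phi [[PhiX _] PhiD PhiM PhiZ [symPhi Phi_ge0]]] := sym_functional_calculus_psd psdM.1.
exists (Phi (fun x => Num.sqrt `|x|)); split.
  by apply: (Phi_ge0 _ _).1 => x; exact: sqrtr_ge0.
rewrite -PhiM; have -> : (fun x => Num.sqrt `|x|) \* (fun x => Num.sqrt `|x|) = @Num.norm R R.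
  by apply/funext => x /=; rewrite -expr2 sqr_sqrtr.
pose neg (x : R) := `|x| + -1 * x.
have negE : Phi neg = Phi (@Num.norm R R) - M.
  by rewrite (PhiD (@Num.norm R R) (fun x => -1 * x)) PhiZ PhiX scaleN1r.
have neg0 x : 0 <= neg x by rewrite /neg mulN1r subr_ge0 ler_norm.
(* [neg ^+ 2 = -2 x neg], so [Phi neg] has nonpositive squared norm when [M] is psd. *)
have : frob_norm (Phi neg) ^+ 2 <= 0.
  rewrite sqr_frob_norm_inner /frob_inner symPhi -PhiM.
  have -> : neg \* neg = fun x => -2 * (neg \* id) x.
    apply/funext => x; rewrite /neg /=.
    have : `|x| * `|x| = x * x by rewrite -!expr2 real_normK ?num_real.
    by move=> h; rewrite mulrDl !mulrDr h; ring.
  rewrite PhiZ PhiM PhiX linearZ /= mulNr oppr_le0 mulr_ge0 //.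
  exact: (Phi_ge0 _ neg0).2.
move=> neg_le0; apply/eqP; rewrite -subr_eq0 -negE; apply/eqP/frob_norm_eq0/eqP.
by rewrite -sqrf_eq0 eq_le neg_le0 sqr_ge0.
Qed.

(* With T = S - P and Q = S + P one has S^2 - P^2 = (T Q + Q T) / 2; pairing it with
   sgn T gives tr (|T| Q), which dominates tr (T^2) since - Q <= T <= Q. *)
Lemma powers_stormer n (S P : 'M[R]_n.+1) : psd S -> psd P ->
  frob_norm (S - P) ^+ 2 <= Num.sqrt n.+1%:R * frob_norm (S *m S - P *m P).
Proof.
move=> psdS psdP; pose T := S - P; pose Q := S + P.
have symT : T^T = T by rewrite linearB /= psdS.1 psdP.1.
have [Phi [[PhiX Phi1] PhiD PhiM PhiZ [symPhi Phi_ge0]]] :=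
  sym_functional_calculus_psd symT.
pose J := Phi (@Num.sg R).
have symJ : J^T = J := symPhi _.
have JT : J *m T = Phi (@Num.norm R R).
  by rewrite -{1}PhiX -PhiM; congr Phi; apply/funext => x /=; rewrite -normrEsg.
have TJ : T *m J = Phi (@Num.norm R R).
  by rewrite -{1}PhiX -PhiM; congr Phi; apply/funext => x /=; rewrite mulrC -normrEsg.
have JE : \tr (J *m (S *m S - P *m P)) = \tr (Phi (@Num.norm R R) *m Q).
  have -> : S *m S - P *m P = 2^-1 *: (T *m Q + Q *m T).
    rewrite /T /Q !mulmxBl !mulmxBr !mulmxDl !mulmxDr.
    by apply/matrixP => i j; rewrite !mxE; field.
  rewrite -scalemxAr linearZ /= mulmxDr linearD /= !mulmxA JT.
  by rewrite [X in _ + X]mxtrace_mulC mulmxA TJ; field.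
(* The squared norm of J is tr (J J), and sgn^2 <= 1 bounds it by the trace of the identity. *)
have J_le : frob_norm J <= Num.sqrt n.+1%:R.
  rewrite -ler_sqr ?nnegrE ?sqrtr_ge0 ?frob_norm_ge0 //.
  rewrite sqr_frob_norm_inner sqr_sqrtr ?ler0n // /frob_inner symJ -PhiM.
  rewrite -[leRHS](mxtrace1 R) -Phi1 -subr_ge0; set f := _ \* _.
  have -> : \tr (Phi (fun=> 1)) - \tr (Phi f) =
      \tr (Phi ((fun=> 1) \+ (fun x => -1 * f x)) *m 1%:M).
    by rewrite mulmx1 PhiD PhiZ linearD /= scaleN1r linearN.
  apply: (Phi_ge0 _ _).2 => [x|].
    by rewrite /f /= mulN1r subr_ge0 -expr2 sqr_sg; case: (x != 0).
  by rewrite -[1%:M]mulmx1 -{2}trmx1; exact: psd_gram.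
pose pos (x : R) := 2^-1 * (`|x| + x); pose neg (x : R) := 2^-1 * (`|x| + -1 * x).
have pos0 x : 0 <= pos x.
  by rewrite mulr_ge0 ?invr_ge0 ?ler0n // -lerBlDr sub0r -normrN ler_norm.
have neg0 x : 0 <= neg x.
  by rewrite mulr_ge0 ?invr_ge0 ?ler0n // mulN1r subr_ge0 ler_norm.
have posE : Phi pos = 2^-1 *: (Phi (@Num.norm R R) + T).
  by rewrite /pos PhiZ (PhiD (@Num.norm R R) id) PhiX.
have negE : Phi neg = 2^-1 *: (Phi (@Num.norm R R) - T).
  by rewrite /neg PhiZ (PhiD (@Num.norm R R) (fun x => -1 * x)) PhiZ PhiX scaleN1r.
have TT : frob_norm T ^+ 2 <= \tr (Phi (@Num.norm R R) *m Q).
  (* With T+ and T- the positive and negative parts of T, tr (T+ P) + tr (T- S) is half of tr (|T|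
     Q) - tr (T^2). *)
  have := addr_ge0 ((Phi_ge0 _ pos0).2 _ psdP) ((Phi_ge0 _ neg0).2 _ psdS).
  rewrite sqr_frob_norm_inner /frob_inner symT posE negE /T /Q -subr_ge0.
  set N := Phi _; rewrite -!scalemxAl !(mulmxDl, mulmxDr, mulNmx, mulmxN).
  by rewrite !(mxtraceD, mxtraceZ, raddfN) /=; lra.
apply: le_trans TT _; rewrite -JE -symJ.
apply: le_trans (ler_norm _) _; apply: le_trans (normr_frob_inner_le _ _) _.
by rewrite ler_wpM2r ?frob_norm_ge0.
Qed.

End SquareRoot.

(** * Linear decay equations and derivatives of Gram matrices *)

Section Decay.
Variable R : realType.

(** The integrating factor exp (k t) makes the product constant. The reference time is 1 because the
    equation holds only on t > 0, with no continuity assumed at 0. *)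
Lemma exp_decay_of_derive (k : R) (f : R -> R) :
  (forall t : R, 0 < t -> is_derive t 1 f (- k * f t)) ->
  forall t : R, 0 < t -> f t = f 1 * expR (k - k * t).
Proof.
move=> df.
pose g := f * (fun s => expR (k * s)).
have dg (t : R) : 0 < t -> is_derive t 1 g 0.
  move=> /df dft; have de : is_derive t 1 (fun s => expR (k * s)) (k * expR (k * t)).
    have dk : is_derive t 1 (k *: (id : R -> R)) (k *: 1) by exact: is_deriveZ.
    apply: (is_derive_eq (is_derive1_comp (is_derive_expR _) dk)).
    by rewrite /GRing.scale /= mulr1 mulrC.
  by apply: is_derive_eq; rewrite /GRing.scale /=; ring.
have gcst (a b : R) : 0 < a -> a <= b -> g b = g a.
  move=> a0 ab.
  have ab_gt0 x : a <= x -> 0 < x by exact: lt_le_trans.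
  have [||c _ /eqP] := @MVT_segment R g (fun=> 0) a b ab.
  - by move=> x; rewrite in_itv /= => /andP[/ltW/ab_gt0/dg].
  - apply: derivable_within_continuous => x; rewrite in_itv /= => /andP[/ab_gt0/dg dgx _].
    exact: ex_derive.
  by rewrite mul0r subr_eq0 => /eqP.
move=> t t0; have gt1 : g t = g 1.
  by case: (leP t 1) => [/gcst->|/ltW/gcst->].
have {}gt1 : f t * expR (k * t) = f 1 * expR k by rewrite -[in RHS](mulr1 k).
apply: (mulIf (x := expR (k * t))); first by rewrite gt_eqF ?expR_gt0.
by rewrite gt1 -mulrA -expRD subrK.
Qed.

Lemma is_derive_gram_entry p q (X : R -> 'M[R]_(p, q)) t i j : derivable X t 1 ->
  is_derive t 1 (fun s => ((X s)^T *m X s) i j)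
    ((('D_1 X t)^T *m X t + (X t)^T *m 'D_1 X t) i j).
Proof.
move=> dX; have dXij k l : is_derive t 1 (fun s => X s k l) ('D_1 X t k l).
  by rewrite derive_mx // mxE; apply: derivableP; exact: (derivable_mxP _ _ _).1.
have -> : (fun s => ((X s)^T *m X s) i j) = \sum_k ((fun s => X s k i) * (fun s => X s k j)).
  apply/funext => s; rewrite mxE fct_sumE; apply: eq_bigr => k _.
  by rewrite mxE.
apply: is_derive_eq; rewrite mxE [X in _ = X + _]mxE [X in _ = _ + X]mxE -big_split /=.
by apply: eq_bigr => k _; rewrite !mxE /GRing.scale /=; ring.
Qed.

End Decay.

(** * The algebraic balance between the two gradients *)

Section GradientFlow.
Variable R : realType.

Lemma sqr_frob_norm_line p q (X H : 'M[R]_(p, q)) h :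
  frob_norm (h *: H + X) ^+ 2 =
  frob_norm X ^+ 2 + h * (2 * frob_inner X H + h * frob_norm H ^+ 2).
Proof.
rewrite !sqr_frob_norm frob_innerE.
rewrite !(mulr_sumr, mulrDr) -!big_split /=; apply: eq_bigr => i _.
rewrite !(mulr_sumr, mulrDr) -!big_split /=; apply: eq_bigr => j _.
by rewrite !mxE; ring.
Qed.

(* The curves h |-> (A + h A Z) B^T and h |-> A (B + h B Z^T)^T coincide, so the
   derivatives of [L] along them cancel in the difference of the two gradients. *)
Lemma gradient_balance m n r (L : 'M[R]_(m, n) -> R) lambda
    (A GA : 'M[R]_(m, r)) (B GB : 'M[R]_(n, r)) :
  is_gradient (fun X => loss_L2 L lambda X B) A GA ->
  is_gradient (fun Y => loss_L2 L lambda A Y) B GB ->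
  GA^T *m A - B^T *m GB = lambda *: (A^T *m A - B^T *m B).
Proof.
move=> [dfA gA] [dfB gB].
have key (Z : 'M[R]_r) : frob_inner GA (A *m Z) - frob_inner GB (B *m Z^T) =
    lambda * (frob_inner A (A *m Z) - frob_inner B (B *m Z^T)).
  rewrite -gA -gB -!deriveE //.
  set H := A *m Z; set K := B *m Z^T.
  have cA := @diff_derivable _ _ _ _ _ H dfA.
  have cB := @diff_derivable _ _ _ _ _ K dfB.
  (* Once L cancels, only the quadratic penalties remain, and the difference of the two difference
     quotients is exactly c + h d. *)
  set c := lambda * _; set d := lambda / 2 * (frob_norm H ^+ 2 - frob_norm K ^+ 2).
  have cd : (fun h : R => c + h * d) h @[h --> 0^'] --> c.
    rewrite [X in _ --> X](_ : c = c + 0 * d); last by rewrite mul0r addr0.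
    apply: cvgD; first exact: cvg_cst.
    by apply: cvgM; [exact: cvg_within|exact: cvg_cst].
  apply: (cvg_unique (@norm_hausdorff R R) (cvgB cA cB)).
  apply: cvg_trans cd; apply: near_eq_cvg; near=> h.
  have h0 : h != 0 by near: h; exact: nbhs_dnbhs_neq.
  rewrite /= -[RHS]/(h^-1 * (_ - _) - h^-1 * (_ - _)) /loss_L2 !sqr_frob_norm_line.
  have -> : (h *: H + A) *m B^T = A *m (h *: K + B)^T.
    rewrite linearD linearZ /= mulmxDl mulmxDr -scalemxAl -scalemxAr /H /K.
    by rewrite trmx_mul trmxK mulmxA.
  by rewrite /c /d; field.
(* The defect M is trace-orthogonal to every Z; the choice Z = M^T then forces M = 0. *)
pose M := GA^T *m A - B^T *m GB - lambda *: (A^T *m A - B^T *m B).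
have trM Z : \tr (M *m Z) = 0.
  have tr_swap (X Y : 'M[R]_(n, r)) : frob_inner X (Y *m Z^T) = \tr (Y^T *m X *m Z).
    by rewrite /frob_inner -mxtrace_tr !trmx_mul !trmxK -mulmxA mxtrace_mulC.
  have := key Z; rewrite !tr_swap /frob_inner !mulmxA => keyZ.
  rewrite /M !mulmxBl -scalemxAl mulmxBl !(linearB, linearZ) /= keyZ.
  by rewrite /GRing.scale /=; ring.
apply/eqP; rewrite -subr_eq0 -/M -[M]trmxK; apply/eqP.
rewrite (_ : M^T = 0) ?trmx0 //; apply: frob_norm_eq0; apply/eqP.
by rewrite -sqrf_eq0 sqr_frob_norm_inner /frob_inner trmxK trM.
Unshelve. all: by end_near. Qed.

End GradientFlow.

(** * The imbalance: its control of the nuclear norm gap, and its evolution *)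

Section Balancedness.
Variable R : realType.

(** The difference equals - tr D / 2 - tr (S - P), and the two terms of the bound estimate these
    traces separately. The first is linear in |D|; the second, by Powers--Stormer, is of order sqrt
    |D|. *)
Lemma nuclear_norm_gap m n r (A : 'M[R]_(m.+1, r)) (B : 'M[R]_(n, r))
    (D := A^T *m A - B^T *m B) :
  `|2^-1 * (frob_norm A ^+ 2 + frob_norm B ^+ 2) - nuclear_norm (A *m B^T)| <=
    2^-1 * (Num.sqrt r%:R * frob_norm D) +
    Num.sqrt m.+1%:R * Num.sqrt (Num.sqrt m.+1%:R * (frob_norm A ^+ 2 * frob_norm D)).
Proof.
rewrite /nuclear_norm; set W := A *m B^T; set S := psd_sqrt _.
have [psdS SS] : psd S /\ S *m S = W *m W^T.
  by apply: (xgetPex 0 (psd_sqrt_exists (psd_gram W))).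
pose P := A *m A^T; have psdP : psd P := psd_gram A.
have -> : 2^-1 * (frob_norm A ^+ 2 + frob_norm B ^+ 2) - \tr S =
    - (2^-1 * \tr D) - \tr (S - P).
  rewrite /D !sqr_frob_norm_inner /frob_inner !linearB /= /P (mxtrace_mulC A).
  by field.
apply: le_trans (ler_normB _ _) _; rewrite normrN normrM ger0_norm ?invr_ge0 //.
apply: lerD; first by rewrite ler_wpM2l ?invr_ge0 // normr_tr_le.
apply: le_trans (normr_tr_le _) _; rewrite ler_wpM2l ?sqrtr_ge0 //.
rewrite -[leLHS]ger0_norm ?frob_norm_ge0 // -sqrtr_sqr ler_wsqrtr //.
apply: le_trans (powers_stormer psdS psdP) _; rewrite ler_wpM2l ?sqrtr_ge0 //.
have -> : S *m S - P *m P = - 1 *: (A *m D *m A^T).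
  by rewrite SS scaleN1r mulmxBr mulmxBl opprB /W /P trmx_mul trmxK !mulmxA.
rewrite frob_normZ normrN1 mul1r; apply: le_trans (frob_norm_mul_le _ _) _.
rewrite frob_norm_tr mulrC expr2 -mulrA ler_wpM2l ?frob_norm_ge0 //.
exact: frob_norm_mul_le.
Qed.

(** D' is the sum of A'^T A - B^T B' and its transpose. By [gradient_balance] each equals - (lambda
    / tau) D, whence the factor 2 in the rate. *)
Lemma gradient_flow_imbalance m n r (L : 'M[R]_(m, n) -> R) lambda tau
    (A : R -> 'M[R]_(m, r)) (B : R -> 'M[R]_(n, r))
    (D := fun t => (A t)^T *m A t - (B t)^T *m B t) :
  0 < tau ->
  (forall t : R, 0 < t -> derivable A t 1 /\
     is_gradient (fun X => loss_L2 L lambda X (B t)) (A t) (- (tau *: 'D_1 A t))) ->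
  (forall t : R, 0 < t -> derivable B t 1 /\
     is_gradient (fun Y => loss_L2 L lambda (A t) Y) (B t) (- (tau *: 'D_1 B t))) ->
  forall t, 0 < t ->
    D t = expR (2 * lambda / tau - 2 * lambda / tau * t) *: D 1.
Proof.
move=> tau0 hA hB t t0; apply/matrixP => i j; rewrite [RHS]mxE [RHS]mulrC.
apply: (@exp_decay_of_derive _ _ (fun s => D s i j)) t0 => {}t t0.
have [dA gA] := hA _ t0; have [dB gB] := hB _ t0.
have balance : ('D_1 A t)^T *m A t - (B t)^T *m 'D_1 B t = - (lambda / tau) *: D t.
  apply: (scalerI (a := - tau)); first by rewrite oppr_eq0 gt_eqF.
  rewrite scalerA mulrNN mulrCA divff ?gt_eqF // mulr1 -(gradient_balance gA gB).
  by rewrite linearN linearZ /= mulNmx mulmxN opprK -scalemxAl -scalemxAr scalerBr !scaleNr opprK.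
have symD : (D t)^T = D t by rewrite linearB /= !trmx_mul !trmxK.
have balanceT : (A t)^T *m 'D_1 A t - ('D_1 B t)^T *m B t = - (lambda / tau) *: D t.
  by rewrite -symD -linearZ -balance linearB /= !trmx_mul !trmxK.
have -> : (fun s => D s i j) =
    (fun s => ((A s)^T *m A s) i j) - (fun s => ((B s)^T *m B s) i j).
  by apply/funext => s; rewrite [LHS]mxE [X in _ + X]mxE.
apply: (is_derive_eq (is_deriveB (is_derive_gram_entry i j dA) (is_derive_gram_entry i j dB))).
have -> : 2 * lambda / tau = lambda / tau + lambda / tau by rewrite -mulrA mulr_natl mulr2n.
rewrite [in RHS]opprD [RHS]mulrDl.
have {1}<- : (('D_1 A t)^T *m A t - (B t)^T *m 'D_1 B t) i j = - (lambda / tau) * D t i j.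
  by rewrite balance [LHS]mxE.
have <- : ((A t)^T *m 'D_1 A t - ('D_1 B t)^T *m B t) i j = - (lambda / tau) * D t i j.
  by rewrite balanceT [LHS]mxE.
move: (_ *m A t) (_ *m 'D_1 A t) (_ *m B t) (_ *m 'D_1 B t) => X Y Z W.
by rewrite !mxE; ring.
Qed.

End Balancedness.

(** * Exponential decay of the loss gap *)

Theorem theorem2 (R : realType) (m n r : nat)
  (hr : (1 <= r)%N) (hrm : (r <= m)%N) (hrn : (r <= n)%N)
  (L : 'M[R]_(m, n) -> R) (hL : forall X, differentiable L X)
  (lambda tau : R) (hlambda : 0 < lambda) (htau : 0 < tau)
  (A : R -> 'M[R]_(m, r)) (B : R -> 'M[R]_(n, r))
  (hA : forall t, 0 < t -> derivable A t 1 /\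
     is_gradient (fun X => loss_L2 L lambda X (B t)) (A t) (- (tau *: 'D_1 A t)))
  (hB : forall t, 0 < t -> derivable B t 1 /\
     is_gradient (fun Y => loss_L2 L lambda (A t) Y) (B t) (- (tau *: 'D_1 B t)))
  (hbound : exists M : R, forall t, 0 <= t ->
     frob_norm (A t) <= M /\ frob_norm (B t) <= M) :
  exists C c : R, 0 < C /\ 0 < c /\ forall t, 0 <= t ->
    `| loss_L2 L lambda (A t) (B t) - loss_nuc L lambda (A t *m (B t)^T) |
      <= C * expR (- (c * t)).
Proof.
case: m hrm L hL A hA hB hbound => [|m] hrm L hL A hA hB [M hM].
  by move: (leq_trans hr hrm).
pose gap t := `|loss_L2 L lambda (A t) (B t) - loss_nuc L lambda (A t *m (B t)^T)|.
pose D t := (A t)^T *m A t - (B t)^T *m B t.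
(* The rate c is half that of D, since the gap is of order sqrt |D|. K absorbs the reference time 1,
   so that |D t| = K exp (- 2 c t). *)
pose c := lambda / tau; pose K := expR (2 * c) * frob_norm (D 1).
have c_gt0 : 0 < c by exact: divr_gt0.
have K_ge0 : 0 <= K by rewrite mulr_ge0 ?expR_ge0 ?frob_norm_ge0.
pose C1 := lambda * (2^-1 * (Num.sqrt r%:R * K) +
  Num.sqrt m.+1%:R * Num.sqrt (Num.sqrt m.+1%:R * (M ^+ 2 * K))).
have C1_ge0 : 0 <= C1.
  rewrite mulr_ge0 ?(ltW hlambda) // addr_ge0 // mulr_ge0 ?sqrtr_ge0 ?invr_ge0 //.
  by rewrite mulr_ge0 ?sqrtr_ge0.
have gap_le t : 0 < t -> gap t <= C1 * expR (- (c * t)).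
  move=> t0; set x := expR _.
  have normD : frob_norm (D t) = K * x ^+ 2.
    rewrite /D (gradient_flow_imbalance htau hA hB t0) frob_normZ ger0_norm ?expR_ge0 //.
    rewrite /K /x [RHS]mulrAC -expRM_natl -expRD; congr (expR _ * _).
    by rewrite /c; field; rewrite gt_eqF.
  have x_ge0 : 0 <= x := expR_ge0 _.
  have x_le1 : x <= 1 by rewrite -expR0 ler_expR oppr_le0 mulr_ge0 // ltW.
  have -> : gap t = lambda * `|2^-1 * (frob_norm (A t) ^+ 2 + frob_norm (B t) ^+ 2)
                               - nuclear_norm (A t *m (B t)^T)|.
    rewrite -[X in X * _](ger0_norm (ltW hlambda)) -normrM /gap /loss_L2 /loss_nuc.
    by congr `|_|; field.
  rewrite /C1 -mulrA ler_wpM2l ?(ltW hlambda) //.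
  apply: le_trans (nuclear_norm_gap (A t) (B t)) _; rewrite -/(D t) normD.
  (* The term linear in |D| carries x^2, which is at most x because x <= 1; the square-root term
     yields the factor x exactly. *)
  rewrite mulrDl; apply: lerD.
    rewrite -[leRHS]mulrA ler_wpM2l ?invr_ge0 // -[leRHS]mulrA ler_wpM2l ?sqrtr_ge0 //.
    by rewrite ler_wpM2l // expr2 ler_piMl.
  rewrite -[leRHS]mulrA ler_wpM2l ?sqrtr_ge0 // -[x in leRHS](ger0_norm x_ge0).
  rewrite -sqrtr_sqr -sqrtrM; last first.
    by rewrite mulr_ge0 ?sqrtr_ge0 // mulr_ge0 ?sqr_ge0.
  rewrite ler_wsqrtr // -[leRHS]mulrA ler_wpM2l ?sqrtr_ge0 // mulrA ler_wpM2r ?sqr_ge0 //.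
  rewrite ler_wpM2r //.
  have [AM _] := hM t (ltW t0).
  by rewrite ler_sqr ?nnegrE ?frob_norm_ge0 // (le_trans (frob_norm_ge0 _) AM).
have gap0_ge0 : 0 <= gap 0 := normr_ge0 _.
(* The summand [gap 0] covers t = 0, where the flow equations are not assumed; the 1 makes the
   constant strictly positive. *)
exists (C1 + gap 0 + 1), c; split; first by rewrite ltr_wpDl ?addr_ge0.
split=> // t; rewrite le_eqVlt => /predU1P[<-|t0]; rewrite -/(gap _).
  by rewrite mulr0 oppr0 expR0 mulr1 -addrA addrCA lerDl addr_ge0.
apply: le_trans (gap_le t t0) _; rewrite ler_wpM2r ?expR_ge0 //.
by rewrite -addrA lerDl addr_ge0.
Qed.
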